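(* Let $A \in \mathbb{M}_{m,n}$ and $B \in \mathbb{M}_{n,m}$. The following statements are equivalent: (i) $\det(I + UAVB) \neq 0$ for all $U \in \mathbb{U}_m$ and all $V \in \mathbb{U}_n$; (ii) there exist $\gamma \in \mathbb{R}$ and $\xi \in \{-1, 1\}$ such that $$P = \begin{bmatrix} -\xi\gamma^2 I_n & 0 \\ 0 & \xi I_m \end{bmatrix} \in \mathbb{H}_{n+m}$$ satisfies $$\begin{bmatrix} I & -A^* \end{bmatrix} P \begin{bmatrix} I \\ -A \end{bmatrix} \prec 0 \quad\text{and}\quad \begin{bmatrix} B^* & I \end{bmatrix} P \begin{bmatrix} B \\ I \end{bmatrix} \succ 0;$$ (iii) either $\sigma_1(A)\sigma_1(B) < 1$ or $\sigma_n(A)\sigma_m(B) > 1$.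
   Context: $\mathbb{M}_{m,n}$: complex $m\times n$ matrices; $\mathbb{H}_k$: Hermitian $k\times k$ matrices; $\mathbb{U}_k$: unitary $k\times k$ matrices; $\cdot^*$: conjugate transpose; $\prec,\succ$: (strict) Loewner order. Singular value convention: a matrix $A\in\mathbb{M}_{m,n}$ has $n$ singular values (as many as columns), $\sigma_i(A) = \sqrt{\lambda_i(A^*A)}$, sorted in nonincreasing order; hence if $n>m$, then $\sigma_{m+1}(A)=\cdots=\sigma_n(A)=0$. *)

(* Defs.v *)
From HB Require Import structures.
From mathcomp Require Import all_boot all_order all_algebra.
From mathcomp Require Import complex.
From mathcomp Require Import reals.

Set Implicit Arguments.
Unset Strict Implicit.
Unset Printing Implicit Defensive.

Import Order.TTheory GRing.Theory Num.Theory.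
Local Open Scope ring_scope.
Local Open Scope complex_scope.
Local Open Scope sesquilinear_scope.

(* The field of complex numbers is R[i] for R : realType; it carries the      *)
(* numClosedFieldType structure used for ^t*, unitarymx and hermsymmx.        *)

(* In R[i], 0 < z entails that z is real. *)
Definition posdefmx (R : realType) (k : nat) (M : 'M[R[i]]_k) : Prop :=
  M \is hermsymmx /\
  forall x : 'cV[R[i]]_k, x != 0 -> 0 < (x ^t* *m M *m x) 0 0.

(* Strict Loewner order on Hermitian matrices: M is below N. *)
Definition loewner_lt (R : realType) (k : nat) (M N : 'M[R[i]]_k) : Prop :=
  [/\ M \is hermsymmx, N \is hermsymmx & posdefmx (N - M)].

(* Listed with algebraic multiplicity. *)
Definition eigenvalues (R : realType) (k : nat) (M : 'M[R[i]]_k) : seq R[i] :=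
  sval (closed_field_poly_normal (char_poly M)).

(* Meant for Hermitian M, whose eigenvalues are real, so that taking real     *)
(* parts only changes the type.                                               *)
Definition sorted_eigenvalues (R : realType) (k : nat) (M : 'M[R[i]]_k) :
    seq R :=
  sort >=%R [seq complex.Re z | z <- eigenvalues M].

(* The index i is 1-based: the singular values of A : 'M_(m, n) are           *)
(* singular_value A i for 1 <= i <= n, one for each column of A.              *)
Definition singular_value (R : realType) (m n : nat) (A : 'M[R[i]]_(m, n))
    (i : nat) : R :=
  Num.sqrt (nth 0 (sorted_eigenvalues (A ^t* *m A)) i.-1).

(* Main.v *)
Require Import Defs.
From mathcomp Require Import all_boot all_order all_algebra.
From mathcomp Require Import complex.
From mathcomp Require Import reals.
From mathcomp Require Import ring lra.

(** Everything is governed by the gain |A x|^2 / |x|^2 of a matrix on nonzero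
    vectors.  By the spectral theorem for A^* A its values are exactly those of the
    interval [sigma_n(A)^2, sigma_1(A)^2] (singular_value_range).

    The matrix I + U A V B is singular when some x <> 0 satisfies
    U A V B x = - x.  Unitary matrices preserve norms and can carry any vector to any
    other of the same norm (unitary_transitive), so such U, V and x exist if and
    only if a gain of A and a gain of B have product 1.  The products of gains fill
    the interval from (sigma_n(A) sigma_m(B))^2 to (sigma_1(A) sigma_1(B))^2, and
    avoiding 1 means lying entirely below or entirely above it.  This yields the
    passage between nonsingularity and singular values, in
    singular_values_of_det_neq0 and det_neq0_of_singular_values.

    The two Loewner inequalities say, for xi = 1, that all gains of A are below
    gamma^2 while gamma^2 times any gain of B is below 1; for xi = -1 both
    inequalities are reversed.  A suitable gamma exists exactly when the products of
    gains stay on one side of 1 (multiplier_of_singular_values,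
    singular_values_of_multiplier). *)

Import Order.TTheory GRing.Theory Num.Theory.
Local Open Scope ring_scope.
Local Open Scope complex_scope.
Local Open Scope sesquilinear_scope.

Set Implicit Arguments.
Unset Strict Implicit.

(** * Squared norms of complex vectors *)

(** Real-valued, so that inequalities between squared norms live in the totally
    ordered field R rather than in R[i]. *)
Definition sqnorm (R : realType) (k : nat) (x : 'cV[R[i]]_k) : R :=
  complex.Re ((x ^t* *m x) 0 0).

Lemma dot_sqnorm (R : realType) (k : nat) (x : 'cV[R[i]]_k) :
  (x ^t* *m x) 0 0 = (sqnorm x)%:C.
Proof.
rewrite /sqnorm RRe_real // mxE; apply: ger0_real; apply: sumr_ge0 => i _.
by rewrite !mxE mulrC -normCK exprn_ge0.
Qed.

Lemma sqnorm_sum (R : realType) (k : nat) (x : 'cV[R[i]]_k) :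
  (sqnorm x)%:C = \sum_i `|x i 0| ^+ 2.
Proof.
by rewrite -dot_sqnorm mxE; apply: eq_bigr => i _; rewrite !mxE mulrC -normCK.
Qed.

Lemma sqnorm_ge0 (R : realType) (k : nat) (x : 'cV[R[i]]_k) : 0 <= sqnorm x.
Proof.
by rewrite -lecR sqnorm_sum sumr_ge0 // => i _; rewrite exprn_ge0.
Qed.

Lemma sqnorm_eq0 (R : realType) (k : nat) (x : 'cV[R[i]]_k) :
  (sqnorm x == 0) = (x == 0).
Proof.
apply/eqP/eqP => [x0|->]; last by rewrite /sqnorm mulmx0 mxE.
apply/matrixP => i j; rewrite ord1 mxE.
have := congr1 (real_complex R) x0; rewrite sqnorm_sum => /eqP.
rewrite psumr_eq0 => [/allP/(_ i (mem_index_enum _))|? _]; last first.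
  by rewrite exprn_ge0.
by rewrite /= expf_eq0 /= normr_eq0 => /eqP.
Qed.

Lemma sqnorm_gt0 (R : realType) (k : nat) (x : 'cV[R[i]]_k) :
  (0 < sqnorm x) = (x != 0).
Proof. by rewrite lt_def sqnorm_ge0 andbT sqnorm_eq0. Qed.

Lemma trmxC_mul (R : realType) (m n p : nat) (A : 'M[R[i]]_(m, n))
    (B : 'M[R[i]]_(n, p)) : (A *m B) ^t* = B ^t* *m A ^t*.
Proof. by rewrite trmx_mul map_mxM. Qed.

Lemma sqnormN (R : realType) (k : nat) (x : 'cV[R[i]]_k) :
  sqnorm (- x) = sqnorm x.
Proof.
by apply: complexI; rewrite !sqnorm_sum; apply: eq_bigr => i _; rewrite mxE normrN.
Qed.

Lemma sqnormZ (R : realType) (k : nat) (a : R) (x : 'cV[R[i]]_k) :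
  sqnorm (a%:C *: x) = a ^+ 2 * sqnorm x.
Proof.
apply: complexI; rewrite rmorphM rmorphXn /= !sqnorm_sum mulr_sumr.
apply: eq_bigr => i _; rewrite mxE normrM exprMn; congr (_ * _).
by rewrite real_normK //; apply/complex_realP; exists a.
Qed.

Lemma form_gram (R : realType) (m n : nat) (A : 'M[R[i]]_(m, n))
    (x : 'cV[R[i]]_n) :
  (x ^t* *m (A ^t* *m A) *m x) 0 0 = (sqnorm (A *m x))%:C.
Proof. by rewrite -dot_sqnorm trmxC_mul !mulmxA. Qed.

Lemma unitarymx_trmxC_mul (R : realType) (k : nat) (U : 'M[R[i]]_k) :
  U \is unitarymx -> U ^t* *m U = 1%:M.
Proof. by rewrite -trmxC_unitary => /unitarymxP; rewrite trmxCK. Qed.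

Lemma sqnorm_unitary (R : realType) (k : nat) (U : 'M[R[i]]_k)
    (x : 'cV[R[i]]_k) : U \is unitarymx -> sqnorm (U *m x) = sqnorm x.
Proof.
move=> /unitarymx_trmxC_mul UU; apply: complexI.
by rewrite -form_gram UU mulmx1 dot_sqnorm.
Qed.

(** * Transitivity of the unitary group on spheres *)

Lemma conj_dot (R : realType) (k : nat) (x y : 'cV[R[i]]_k) :
  Num.conj ((x ^t* *m y) 0 0) = (y ^t* *m x) 0 0.
Proof.
have -> : y ^t* *m x = (x ^t* *m y) ^t* by rewrite trmxC_mul trmxCK.
by rewrite [RHS]mxE [in RHS]mxE.
Qed.

(** With w = x - y, the map I - (w^* x)^-1 w w^* sends x to x - w = y.  Equality of
    the norms gives w^* w = w^* x + x^* w, and this is exactly the condition on the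
    coefficient that makes such a rank-one perturbation of I unitary.  Taking the
    non-Hermitian coefficient (w^* x)^-1, instead of the 2 / (w^* w) of a Householder
    reflection, avoids having to make x^* y real beforehand. *)
Lemma unitary_transitive (R : realType) (k : nat) (x y : 'cV[R[i]]_k) :
  sqnorm x = sqnorm y -> exists2 U : 'M[R[i]]_k, U \is unitarymx & U *m x = y.
Proof.
move=> xy; pose w := x - y.
have [/eqP|w0] := eqVneq w 0.
  rewrite subr_eq0 => /eqP ->; exists 1%:M; last by rewrite mul1mx.
  by apply/unitarymxP; rewrite mul1mx trmx1 map_mx1.
pose c := (w ^t* *m x) 0 0.
have wwE : (w ^t* *m w) 0 0 = c + Num.conj c.
  have yxE : (y ^t* *m y) 0 0 = (x ^t* *m x) 0 0 by rewrite !dot_sqnorm xy.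
  rewrite /c conj_dot /w !(linearB, map_mxB) /= !mulmxBl.
  move: (x ^t* *m x) (y ^t* *m y) (x ^t* *m y) (y ^t* *m x) yxE.
  by move=> a b p q ba; rewrite !mxE ba; ring.
have c0 : c != 0.
  apply: contraNneq w0 => c0; rewrite -sqnorm_eq0; apply/eqP/complexI.
  by rewrite -dot_sqnorm wwE c0 conjC0 addr0.
exists (1%:M - c^-1 *: (w *m w ^t*)); last first.
  rewrite mulmxBl mul1mx -scalemxAl -mulmxA [_ *m x]mx11_scalar -/c.
  by rewrite mul_mx_scalar scalerA mulVf // scale1r /w opprB addrC subrK.
apply/unitarymxP.
set X := w *m w ^t*.
have XE : X ^t* = X by rewrite trmxC_mul trmxCK.
have XX : X *m X = (c + Num.conj c) *: X.
  rewrite /X mulmxA -(mulmxA w) [_ ^t* *m w]mx11_scalar wwE.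
  by rewrite mul_mx_scalar -scalemxAl.
have -> : (1%:M - c^-1 *: X) ^t* = 1%:M - (Num.conj c)^-1 *: X.
  rewrite linearB linearZ /= map_mxB map_mxZ /= XE trmx1 map_mx1.
  by rewrite fmorphV.
rewrite mulmxBl mul1mx mulmxBr mulmx1 -scalemxAl -scalemxAr XX !scalerA.
rewrite -scalerBl -addrA -opprD -scalerDl.
have -> : (Num.conj c)^-1 +
    (c^-1 - c^-1 / Num.conj c * (c + Num.conj c)) = 0.
  by field; rewrite conjC_eq0 c0.
by rewrite scale0r subr0.
Qed.

(** * Spectral decomposition of the Gram matrix *)

Lemma hermsym_gram (R : realType) (m n : nat) (A : 'M[R[i]]_(m, n)) :
  A ^t* *m A \is hermsymmx.
Proof. by rewrite qualifE /= expr0 scale1r trmxC_mul trmxCK. Qed.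

Lemma char_poly_conj (F : fieldType) (k : nat) (P D : 'M[F]_k) :
  P \in unitmx -> char_poly (invmx P *m D *m P) = char_poly D.
Proof.
move=> Pu; rewrite /char_poly /char_poly_mx.
have PXu : map_mx polyC P \in unitmx by rewrite map_unitmx.
have -> : 'X%:M - map_mx polyC (invmx P *m D *m P) =
          invmx (map_mx polyC P) *m ('X%:M - map_mx polyC D) *m map_mx polyC P.
  rewrite mulmxBr mulmxBl -map_invmx !map_mxM; congr (_ - _).
  by rewrite scalar_mxC -mulmxA map_invmx mulVmx // mulmx1.
by rewrite !det_mulmx mulrAC det_inv mulVr ?mul1r // -unitmxE.
Qed.

(** Comparing characteristic polynomials identifies the listed eigenvalues with the
    diagonal of the spectral decomposition, multiplicities included. *)
Lemma gram_spectral (R : realType) (m n : nat) (A : 'M[R[i]]_(m, n)) :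
  exists (P : 'M[R[i]]_n) (d : 'I_n -> R),
  [/\ P \is unitarymx,
      forall x, sqnorm (A *m x) = \sum_i d i * sqnorm (row i (P *m x))
    & perm_eq (sorted_eigenvalues (A ^t* *m A)) [seq d i | i : 'I_n]].
Proof.
pose M := A ^t* *m A; pose P := spectralmx M; pose s := spectral_diag M.
have Mh := hermsym_gram A.
have ME : M = invmx P *m diag_mx s *m P.
  exact/orthomx_spectralP/hermitian_normalmx.
have sR i : (complex.Re (s 0 i))%:C = s 0 i.
  exact/RRe_real/mxOverP/hermitian_spectral_diag_real.
have Pu : P \is unitarymx by exact: spectral_unitarymx.
exists P, (fun i => complex.Re (s 0 i)); split=> // [x|].
  apply: complexI; rewrite -form_gram -/M ME invmx_unitary //.
  rewrite !mulmxA -trmxC_mul -!mulmxA mulmxA mxE rmorph_sum /=.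
  apply: eq_bigr => i _; rewrite rmorphM /= sR -dot_sqnorm.
  rewrite [in RHS]mxE big_ord1 mul_mx_diag !mxE.
  by rewrite mulrAC mulrC mulrA.
rewrite /sorted_eigenvalues /eigenvalues; case: closed_field_poly_normal => r /=.
rewrite (monicP (char_poly_monic _)) scale1r -/M {1}ME.
rewrite char_poly_conj ?spectral_unit //.
rewrite char_poly_trig ?diag_mx_is_trig // => rE.
have {}rE : perm_eq r [seq s 0 i | i : 'I_n].
  apply: prod_XsubC_eq; rewrite -rE big_image /=.
  by apply: eq_bigr => i _; rewrite mxE eqxx.
have := perm_map (@complex.Re R) rE; rewrite -map_comp => rE'.
by rewrite perm_sort.
Qed.

(** Sorting puts the largest eigenvalue first and the smallest last.  Both are entries
    of the list, so indices imax and imin can name them among the diagonal entries. *)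
Lemma singular_value_spectral (R : realType) (m n : nat) (n_gt0 : (0 < n)%N)
    (A : 'M[R[i]]_(m, n)) :
  exists (P : 'M[R[i]]_n) (d : 'I_n -> R) (imax imin : 'I_n),
  [/\ P \is unitarymx,
      forall x, sqnorm (A *m x) = \sum_i d i * sqnorm (row i (P *m x)),
      forall i, d imin <= d i <= d imax,
      singular_value A 1 = Num.sqrt (d imax)
    & singular_value A n = Num.sqrt (d imin)].
Proof.
have [P [d [Pu AE ds]]] := gram_spectral A.
set s := sorted_eigenvalues _ in ds.
have ss : size s = n by rewrite (perm_size ds) size_map size_enum_ord.
have s_mem i : (i < n)%N -> exists j, nth 0 s i = d j.
  move=> ltin; have := mem_nth 0 (s := s) (n := i).
  by rewrite ss ltin (perm_mem ds) => /(_ isT)/mapP[j _ ->]; exists j.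
have [//|imax maxE] := s_mem 0%N.
have [|imin minE] := s_mem n.-1; first by rewrite prednK.
have s_sorted : sorted >=%R s by apply: sort_sorted => x y; exact: ge_total.
have ge_tr : transitive (>=%R : rel R) by move=> y x z xy yz; exact: le_trans yz xy.
have le_nth i j : (i <= j)%N -> (j < n)%N -> nth 0 s j <= nth 0 s i.
  move=> leij ltj; apply: (sorted_leq_nth ge_tr _ 0 s_sorted) => //.
  - by move=> x; exact: lexx.
  - by rewrite inE ss (leq_ltn_trans leij).
  - by rewrite inE ss.
exists P, d, imax, imin; split => //; last 2 first.
- by rewrite /singular_value -/s maxE.
- by rewrite /singular_value -/s minE.
move=> i; have : d i \in s by rewrite (perm_mem ds) map_f ?mem_enum.
move=> /(nthP 0)[k ltk <-]; rewrite ss in ltk; rewrite -maxE -minE.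
by rewrite !le_nth //; case: (n) ltk.
Qed.

(** * Rayleigh quotients *)

(** The numerical range of A^* A is the interval spanned by its extreme eigenvalues:
    in spectral coordinates the Rayleigh quotient is a convex combination of the
    eigenvalues, and weights on the two extreme ones already reach every value
    in between. *)
Lemma singular_value_range (R : realType) (m n : nat) (n_gt0 : (0 < n)%N)
    (A : 'M[R[i]]_(m, n)) (a : R) :
  singular_value A n ^+ 2 <= a <= singular_value A 1 ^+ 2 <->
  exists2 x, x != 0 & sqnorm (A *m x) = a * sqnorm x.
Proof.
have [P [d [i [j [Pu AE dij -> ->]]]]] := singular_value_spectral n_gt0 A.
have sqP x : sqnorm x = \sum_k sqnorm (row k (P *m x)).
  rewrite -(sqnorm_unitary x Pu); apply: complexI.
  rewrite sqnorm_sum rmorph_sum /=; apply: eq_bigr => k _.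
  by rewrite sqnorm_sum big_ord1 [in RHS]mxE.
(* Any nonnegative weights are the squared coordinates of some vector. *)
have weights (w : 'I_n -> R) : (forall k, 0 <= w k) ->
    exists x, sqnorm x = \sum_k w k /\ sqnorm (A *m x) = \sum_k d k * w k.
  move=> w0; pose y : 'cV[R[i]]_n := \col_k (Num.sqrt (w k))%:C.
  have yE k : sqnorm (row k y) = w k.
    apply: complexI; rewrite sqnorm_sum big_ord1 !mxE.
    rewrite real_normK; last by apply/complex_realP; eexists.
    by rewrite -rmorphXn /= sqr_sqrtr.
  exists (P ^t* *m y); rewrite sqP AE mulmxA (unitarymxP Pu) mul1mx.
  by split; apply: eq_bigr => k _; rewrite yE.
(* Needed because Num.sqrt truncates negative arguments to 0. *)
have d_ge0 k : 0 <= d k.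
  have [|x [_]] := weights (fun l => (l == k)%:R); first by move=> ?; rewrite ler0n.
  rewrite (bigD1 k) //= eqxx mulr1 big1 ?addr0 => [<-|l /negPf->].
    exact: sqnorm_ge0.
  by rewrite mulr0.
rewrite !sqr_sqrtr //; split=> [/andP[ja ai]|[x]]; last first.
  rewrite -sqnorm_gt0 => x0 Ax.
  rewrite -(ler_pM2r x0) -[a <= _](ler_pM2r x0) -Ax AE sqP !mulr_sumr.
  by rewrite !ler_sum // => k _; rewrite ler_wpM2r ?sqnorm_ge0 //; case/andP: (dij k).
(* When d i = d j, inversion of 0 makes t = 0, which is a correct weight. *)
pose t := (a - d j) / (d i - d j).
have t01 : 0 <= t <= 1.
  rewrite /t divr_ge0 ?subr_ge0 ?(le_trans ja) //=.
  have [->|ne] := eqVneq (d i) (d j); first by rewrite subrr invr0 mulr0.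
  by rewrite ler_pdivrMr ?mul1r ?lerB // subr_gt0 lt_def ne (le_trans ja).
have tE : d j + t * (d i - d j) = a.
  rewrite /t; have [e|ne] := eqVneq (d i) (d j).
    by rewrite e subrr mulr0 addr0; apply/eqP; rewrite eq_le ja -e.
  by rewrite divfK ?subr_eq0 // addrC subrK.
have delta (f : 'I_n -> R) l : \sum_k f k * (k == l)%:R = f l.
  rewrite (bigD1 l) //= eqxx mulr1 big1 ?addr0 // => k /negPf->.
  by rewrite mulr0.
have [|x [x1 xa]] := weights (fun k => (1 - t) * (k == j)%:R + t * (k == i)%:R).
  by move=> k; case/andP: t01 => t0 t1; rewrite addr_ge0 // mulr_ge0 ?ler0n ?subr_ge0.
rewrite big_split (delta (fun=> 1 - t)) (delta (fun=> t)) /= subrK in x1.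
exists x; first by rewrite -sqnorm_eq0 x1 oner_eq0.
clearbody t; rewrite x1 mulr1 xa -tE.
under eq_bigr do rewrite mulrDr !mulrA.
rewrite big_split /= (delta (fun k => d k * (1 - t))) (delta (fun k => d k * t)) /=.
ring.
Qed.

(** The product is continuous on the rectangle [a0, a1] x [b0, b1].  On the edge
    b = b1 and then on the edge a = a0 it goes from at least 1 to at most 1; whichever
    edge contains the crossing yields an explicit solution. *)
Lemma intervals_prod_eq1 (R : realFieldType) (a0 a1 b0 b1 : R) :
  0 <= a0 <= a1 -> 0 <= b0 <= b1 -> a0 * b0 <= 1 <= a1 * b1 ->
  exists a b, [/\ a0 <= a <= a1, b0 <= b <= b1 & a * b = 1].
Proof.
move=> /andP[a00 a01] /andP[b00 b01] /andP[ab0 ab1].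
have b1_gt0 : 0 < b1.
  rewrite lt_def (le_trans b00 b01) andbT; apply: contraTneq ab1 => ->.
  by rewrite mulr0 ler10.
have [le1|lt1] := leP (a0 * b1) 1.
  exists b1^-1, b1; rewrite b01 lexx mulVf ?gt_eqF //; split => //.
  by rewrite -div1r ler_pdivlMr // ler_pdivrMr // le1.
have a0_gt0 : 0 < a0.
  by rewrite lt_def a00 andbT; apply: contraTneq lt1 => ->; rewrite mul0r ltr10.
exists a0, a0^-1; rewrite lexx a01 mulfV ?gt_eqF //; split => //.
by rewrite -div1r ler_pdivlMr // ler_pdivrMr // mulrC ab0 mulrC ltW.
Qed.

Lemma singular_value_bounds (R : realType) (m n : nat) (n_gt0 : (0 < n)%N)
    (A : 'M[R[i]]_(m, n)) (x : 'cV[R[i]]_n) :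
  singular_value A n ^+ 2 * sqnorm x <= sqnorm (A *m x)
    <= singular_value A 1 ^+ 2 * sqnorm x.
Proof.
have [->|x0] := eqVneq x 0.
  by rewrite mulmx0 /sqnorm !mulmx0 !mxE !mulr0 lexx.
have xp : 0 < sqnorm x by rewrite sqnorm_gt0.
rewrite -ler_pdivlMr // -[X in _ && X]ler_pdivrMr //.
by apply/(singular_value_range n_gt0); exists x; rewrite // divfK ?gt_eqF.
Qed.

Lemma singular_value_le (R : realType) (m n : nat) (n_gt0 : (0 < n)%N)
    (A : 'M[R[i]]_(m, n)) : singular_value A n <= singular_value A 1.
Proof.
have [P [d [i [j [_ _ dij -> ->]]]]] := singular_value_spectral n_gt0 A.
by rewrite ler_wsqrtr //; case/andP: (dij i).
Qed.

(** A quadratic inequality bounding |A x|^2 by |x|^2 on nonzero vectors can be read off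
    at the extreme values of the Rayleigh quotient, since both are attained. *)
Lemma singular_value_form_lt (R : realType) (m n : nat) (n_gt0 : (0 < n)%N)
    (A : 'M[R[i]]_(m, n)) (a b : R) :
  (forall x, x != 0 -> a * sqnorm (A *m x) < b * sqnorm x) ->
  a * singular_value A 1 ^+ 2 < b /\ a * singular_value A n ^+ 2 < b.
Proof.
move=> H; have sle : singular_value A n ^+ 2 <= singular_value A 1 ^+ 2.
  by rewrite ler_sqr ?nnegrE ?sqrtr_ge0 ?singular_value_le.
have key c : singular_value A n ^+ 2 <= c <= singular_value A 1 ^+ 2 -> a * c < b.
  case/(singular_value_range n_gt0) => x x0 Ax.
  by move: (H x x0); rewrite Ax mulrA ltr_pM2r // sqnorm_gt0.
by split; apply: key; rewrite ?lexx ?andbT.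
Qed.

(** * Nonsingularity and singular values *)

Lemma det_eq0_vec (F : fieldType) (k : nat) (M : 'M[F]_k) :
  reflect (exists2 x : 'cV_k, x != 0 & M *m x = 0) (\det M == 0).
Proof.
rewrite -det_tr; apply: (iffP det0P) => -[v v0 e].
  by exists v^T; [rewrite trmx_eq0 | rewrite -(trmxK M) -trmx_mul e trmx0].
by exists v^T; [rewrite trmx_eq0 | rewrite -trmx_mul e trmx0].
Qed.

(** A kernel vector x satisfies x = - U A V B x, and the unitary factors preserve norms;
    hence |A V B x| = |x|, whereas |A V B x| / |x| lies between the product of the
    smallest and the product of the largest singular values. *)
Lemma det_neq0_of_singular_values (R : realType) (m n : nat) (m_gt0 : (0 < m)%N)
    (n_gt0 : (0 < n)%N) (A : 'M[R[i]]_(m, n)) (B : 'M[R[i]]_(n, m))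
    (U : 'M[R[i]]_m) (V : 'M[R[i]]_n) : U \is unitarymx -> V \is unitarymx ->
  singular_value A 1 * singular_value B 1 < 1 \/
  1 < singular_value A n * singular_value B m ->
  \det (1%:M + U *m A *m V *m B) != 0.
Proof.
move=> Uu Vu sAB; apply/negP => /det_eq0_vec[x x0].
rewrite mulmxDl mul1mx -!mulmxA => /eqP; rewrite addr_eq0 => /eqP xE.
have xp : 0 < sqnorm x by rewrite sqnorm_gt0.
have nx : sqnorm (A *m (V *m (B *m x))) = sqnorm x.
  by rewrite [in RHS]xE sqnormN sqnorm_unitary.
have /andP[Al Au] := singular_value_bounds n_gt0 A (V *m (B *m x)).
have /andP[Bl Bu] := singular_value_bounds m_gt0 B x.
rewrite nx sqnorm_unitary // in Al Au.
case: sAB => [lt1|gt1].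
  have : sqnorm x <= (singular_value A 1 * singular_value B 1) ^+ 2 * sqnorm x.
    by rewrite exprMn -mulrA (le_trans Au) // ler_wpM2l ?sqr_ge0.
  apply/negP; rewrite -ltNge gtr_pMl //.
  by rewrite expr_lt1 // mulr_ge0 ?sqrtr_ge0.
have : (singular_value A n * singular_value B m) ^+ 2 * sqnorm x <= sqnorm x.
  by rewrite exprMn -mulrA (le_trans _ Al) // ler_wpM2l ?sqr_ge0.
apply/negP; rewrite -ltNge ltr_pMl //.
by rewrite expr_gt1 // mulr_ge0 ?sqrtr_ge0.
Qed.

(** Otherwise the gains of A and of B can be chosen with product 1, at vectors z and x.
    Rescaling z so that |z| = |B x| makes |A z| = |x|; unitary V and U then carry B x
    to z and A z to - x, which puts x in the kernel of I + U A V B. *)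
Lemma singular_values_of_det_neq0 (R : realType) (m n : nat) (m_gt0 : (0 < m)%N)
    (n_gt0 : (0 < n)%N) (A : 'M[R[i]]_(m, n)) (B : 'M[R[i]]_(n, m)) :
  (forall (U : 'M[R[i]]_m) (V : 'M[R[i]]_n),
      U \is unitarymx -> V \is unitarymx ->
      \det (1%:M + U *m A *m V *m B) != 0) ->
  singular_value A 1 * singular_value B 1 < 1 \/
  1 < singular_value A n * singular_value B m.
Proof.
move=> detN0; have [?|ge1] := ltP (singular_value A 1 * singular_value B 1) 1.
  by left.
right; rewrite ltNge; apply/negP => le1.
have sq_le k l (k0 : (0 < l)%N) (M : 'M[R[i]]_(k, l)) :
    0 <= singular_value M l ^+ 2 <= singular_value M 1 ^+ 2.
  by rewrite sqr_ge0 ler_sqr ?nnegrE ?sqrtr_ge0 ?singular_value_le.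
have [|a [b [sa sb ab]]] := intervals_prod_eq1 (sq_le _ _ n_gt0 A) (sq_le _ _ m_gt0 B).
  by rewrite -!exprMn expr_le1 ?expr_ge1 // ?mulr_ge0 ?sqrtr_ge0 // le1 ge1.
have [z z0 Az] := (singular_value_range n_gt0 A a).1 sa.
have [x x0 Bx] := (singular_value_range m_gt0 B b).1 sb.
have xp : 0 < sqnorm x by rewrite sqnorm_gt0.
have zp : 0 < sqnorm z by rewrite sqnorm_gt0.
pose t := Num.sqrt (sqnorm (B *m x) / sqnorm z).
have tz : sqnorm (t%:C *: z) = sqnorm (B *m x).
  by rewrite sqnormZ sqr_sqrtr ?divr_ge0 ?sqnorm_ge0 // divfK ?gt_eqF.
have [V Vu VE] := unitary_transitive (esym tz).
have Atz : sqnorm (A *m (t%:C *: z)) = sqnorm (- x).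
  rewrite -scalemxAr sqnormZ Az mulrCA -sqnormZ tz Bx mulrA ab mul1r.
  by rewrite sqnormN.
have [U Uu UE] := unitary_transitive Atz.
have := detN0 U V Uu Vu; apply/negP; rewrite negbK.
apply/det_eq0_vec; exists x => //.
by rewrite mulmxDl mul1mx -!mulmxA VE UE subrr.
Qed.

(** * Multipliers and Loewner inequalities *)

Lemma form_left (R : realType) (m n : nat) (A : 'M[R[i]]_(m, n)) (p q : R) :
  row_mx 1%:M (- A ^t*) *m block_mx p%:C%:M 0 0 q%:C%:M *m col_mx 1%:M (- A) =
  p%:C%:M + q%:C *: (A ^t* *m A).
Proof.
rewrite mul_row_block !mulmx0 add0r addr0 mul1mx mul_row_col mulmx1.
by rewrite mul_mx_scalar scalerN mulNmx mulmxN opprK scalemxAl.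
Qed.

Lemma form_right (R : realType) (m n : nat) (B : 'M[R[i]]_(n, m)) (p q : R) :
  row_mx (B ^t*) 1%:M *m block_mx p%:C%:M 0 0 q%:C%:M *m col_mx B 1%:M =
  q%:C%:M + p%:C *: (B ^t* *m B).
Proof.
rewrite mul_row_block !mulmx0 add0r addr0 mul1mx mul_row_col mulmx1.
by rewrite mul_mx_scalar -scalemxAl addrC.
Qed.

Lemma conj_real_complex (R : realType) (p : R) : Num.conj (p%:C) = p%:C.
Proof. exact: conjc_real. Qed.

Lemma hermsym_affine (R : realType) (m n : nat) (A : 'M[R[i]]_(m, n)) (p q : R) :
  p%:C%:M + q%:C *: (A ^t* *m A) \is hermsymmx.
Proof.
rewrite qualifE /= expr0 scale1r linearD linearZ /= map_mxD map_mxZ.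
by rewrite tr_scalar_mx map_scalar_mx trmxC_mul trmxCK /= !conj_real_complex.
Qed.

Lemma form_affine (R : realType) (m n : nat) (A : 'M[R[i]]_(m, n)) (p q : R)
    (x : 'cV[R[i]]_n) :
  (x ^t* *m (p%:C%:M + q%:C *: (A ^t* *m A)) *m x) 0 0 =
  (p * sqnorm x + q * sqnorm (A *m x))%:C.
Proof.
rewrite mulmxDr mulmxDl mul_mx_scalar -scalemxAl -scalemxAr -scalemxAl.
by rewrite [LHS]mxE [in LHS]mxE [X in _ + X]mxE form_gram dot_sqnorm !rmorphD !rmorphM.
Qed.

Lemma hermsym_zero (R : realType) k : (0 : 'M[R[i]]_k) \is hermsymmx.
Proof. by rewrite qualifE /= expr0 scale1r trmx0 map_mx0. Qed.

Lemma posdef_affine (R : realType) (m n : nat) (A : 'M[R[i]]_(m, n)) (p q : R) :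
  posdefmx (p%:C%:M + q%:C *: (A ^t* *m A)) <->
  forall x, x != 0 -> 0 < p * sqnorm x + q * sqnorm (A *m x).
Proof.
split=> [[_ H] x /H|H]; first by rewrite form_affine ltcR.
by split=> [|x /H]; rewrite ?hermsym_affine // form_affine ltcR.
Qed.

Lemma loewner_gt0_affine (R : realType) (m n : nat) (A : 'M[R[i]]_(m, n))
    (p q : R) :
  loewner_lt 0 (p%:C%:M + q%:C *: (A ^t* *m A)) <->
  forall x, x != 0 -> 0 < p * sqnorm x + q * sqnorm (A *m x).
Proof.
rewrite /loewner_lt subr0 -posdef_affine; split=> [[]//|H].
by split; rewrite ?hermsym_zero ?hermsym_affine.
Qed.

Lemma loewner_lt0_affine (R : realType) (m n : nat) (A : 'M[R[i]]_(m, n))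
    (p q : R) :
  loewner_lt (p%:C%:M + q%:C *: (A ^t* *m A)) 0 <->
  forall x, x != 0 -> p * sqnorm x + q * sqnorm (A *m x) < 0.
Proof.
have oppE : 0 - (p%:C%:M + q%:C *: (A ^t* *m A)) =
            (- p)%:C%:M + (- q)%:C *: (A ^t* *m A) :> 'M[R[i]]_n.
  by rewrite sub0r opprD -scaleNr -raddfN -!rmorphN.
have -> : loewner_lt (p%:C%:M + q%:C *: (A ^t* *m A)) 0 <->
    posdefmx ((- p)%:C%:M + (- q)%:C *: (A ^t* *m A)).
  rewrite /loewner_lt oppE; split=> [[]//|H].
  by split; rewrite ?hermsym_zero ?hermsym_affine.
rewrite posdef_affine; split=> H x /H; last by rewrite !mulNr -opprD oppr_gt0.
by rewrite !mulNr -opprD oppr_gt0.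
Qed.

Lemma hermsym_multiplier (R : realType) (m n : nat) (p q : R) :
  (block_mx p%:C%:M 0 0 q%:C%:M : 'M[R[i]]_(n + m)) \is hermsymmx.
Proof.
rewrite qualifE /= expr0 scale1r tr_block_mx map_block_mx !trmx0 !map_mx0.
by rewrite !tr_scalar_mx !map_scalar_mx /= !conj_real_complex.
Qed.

Lemma singular_values_of_multiplier (R : realType) (m n : nat)
    (m_gt0 : (0 < m)%N) (n_gt0 : (0 < n)%N) (A : 'M[R[i]]_(m, n))
    (B : 'M[R[i]]_(n, m)) (gamma xi : R) :
  xi = -1 \/ xi = 1 ->
  (forall x, x != 0 ->
     - xi * gamma ^+ 2 * sqnorm x + xi * sqnorm (A *m x) < 0) ->
  (forall x, x != 0 ->
     0 < xi * sqnorm x + - xi * gamma ^+ 2 * sqnorm (B *m x)) ->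
  singular_value A 1 * singular_value B 1 < 1 \/
  1 < singular_value A n * singular_value B m.
Proof.
move=> [->|->] HA HB; [right|left].
  have [|_ sA] := singular_value_form_lt n_gt0 (A := A) (a := -1) (b := - gamma ^+ 2).
    by move=> x /HA; lra.
  have [|_ sB] := singular_value_form_lt m_gt0 (A := B) (a := - gamma ^+ 2) (b := -1).
    by move=> x /HB; lra.
  rewrite -(@expr_gt1 _ 2) ?mulr_ge0 ?sqrtr_ge0 // exprMn.
  have : 1 < gamma ^+ 2 * singular_value B m ^+ 2 by lra.
  move=> /lt_le_trans; apply; rewrite ler_wpM2r ?sqr_ge0 //; lra.
have [|sA _] := singular_value_form_lt n_gt0 (A := A) (a := 1) (b := gamma ^+ 2).
  by move=> x /HA; lra.
have [|sB _] := singular_value_form_lt m_gt0 (A := B) (a := gamma ^+ 2) (b := 1).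
  by move=> x /HB; lra.
rewrite -(@expr_lt1 _ 2) ?mulr_ge0 ?sqrtr_ge0 // exprMn.
apply: le_lt_trans sB; rewrite ler_wpM2r ?sqr_ge0 //; lra.
Qed.

(** A gamma separating sigma_1(A) from 1 / sigma_1(B), or 1 / sigma_m(B) from sigma_n(A),
    is all that is needed, with 1 / 0 read as infinity; the sign xi tells which of the
    two orderings holds. *)
Lemma multiplier_of_singular_values (R : realType) (m n : nat)
    (m_gt0 : (0 < m)%N) (n_gt0 : (0 < n)%N) (A : 'M[R[i]]_(m, n))
    (B : 'M[R[i]]_(n, m)) :
  singular_value A 1 * singular_value B 1 < 1 \/
  1 < singular_value A n * singular_value B m ->
  exists gamma xi : R, [/\ xi = -1 \/ xi = 1,
    forall x, x != 0 ->
      - xi * gamma ^+ 2 * sqnorm x + xi * sqnorm (A *m x) < 0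
  & forall x, x != 0 ->
      0 < xi * sqnorm x + - xi * gamma ^+ 2 * sqnorm (B *m x)].
Proof.
case=> [lt1|gt1].
  set s := singular_value A 1 in lt1 *; set t := singular_value B 1 in lt1 *.
  have s0 : 0 <= s by exact: sqrtr_ge0.
  have t0 : 0 <= t by exact: sqrtr_ge0.
  (* Not the midpoint of s and t^-1, because t may vanish here. *)
  have [g sg gt] : exists2 g, s < g & g * t < 1.
    have t1 : 0 < 1 + t by rewrite ltr_pwDl.
    exists (s + (1 - s * t) / (1 + t)).
      by rewrite ltrDl divr_gt0 // subr_gt0.
    have -> : (s + (1 - s * t) / (1 + t)) * t = 1 - (1 - s * t) / (1 + t).
      by field; lra.
    by rewrite ltrBlDr ltrDl divr_gt0 // subr_gt0.
  have g0 : 0 <= g by rewrite ltW // (le_lt_trans s0).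
  exists g, 1; split; first by right.
    move=> x; rewrite -sqnorm_gt0 => xp.
    have /andP[_ Ax] := singular_value_bounds n_gt0 A x.
    have : s ^+ 2 * sqnorm x < g ^+ 2 * sqnorm x.
      by rewrite ltr_pM2r // ltr_sqr ?nnegrE.
    rewrite -/s in Ax; lra.
  move=> x; rewrite -sqnorm_gt0 => xp.
  have /andP[_ Bx] := singular_value_bounds m_gt0 B x.
  have gBx : g ^+ 2 * sqnorm (B *m x) <= g ^+ 2 * (t ^+ 2 * sqnorm x).
    by rewrite ler_wpM2l ?sqr_ge0.
  have : (g * t) ^+ 2 * sqnorm x < 1 * sqnorm x.
    by rewrite ltr_pM2r // expr_lt1 // mulr_ge0.
  rewrite exprMn -mulrA; lra.
set s := singular_value A n in gt1 *; set t := singular_value B m in gt1 *.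
have s0 : 0 <= s by exact: sqrtr_ge0.
have t_gt0 : 0 < t.
  rewrite lt_def sqrtr_ge0 andbT; apply: contraTneq gt1 => ->.
  by rewrite mulr0 ltr10.
have [g [g0 gs gt]] : exists g, [/\ 0 <= g, g < s & 1 < g * t].
  have ts : t^-1 < s by rewrite -div1r ltr_pdivrMr.
  have t'0 : 0 < t^-1 by rewrite invr_gt0.
  exists ((s + t^-1) / 2); split; [lra|lra|].
  have -> : (s + t^-1) / 2 * t = (s * t + 1) / 2 by field; rewrite gt_eqF.
  lra.
exists g, (-1); split; first by left.
  move=> x; rewrite -sqnorm_gt0 => xp.
  have /andP[Ax _] := singular_value_bounds n_gt0 A x.
  have : g ^+ 2 * sqnorm x < s ^+ 2 * sqnorm x.
    by rewrite ltr_pM2r // ltr_sqr ?nnegrE.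
  rewrite -/s in Ax; lra.
move=> x; rewrite -sqnorm_gt0 => xp.
have /andP[Bx _] := singular_value_bounds m_gt0 B x.
have gBx : g ^+ 2 * (t ^+ 2 * sqnorm x) <= g ^+ 2 * sqnorm (B *m x).
  by rewrite ler_wpM2l ?sqr_ge0.
have : 1 * sqnorm x < (g * t) ^+ 2 * sqnorm x.
  by rewrite ltr_pM2r // expr_gt1 // mulr_ge0 // ltW.
rewrite exprMn -mulrA; lra.
Qed.

(** * The equivalence *)

Theorem mainTheorem7 (R : realType) (m n : nat) (m_gt0 : (0 < m)%N)
    (n_gt0 : (0 < n)%N) (A : 'M[R[i]]_(m, n)) (B : 'M[R[i]]_(n, m)) :
  [<-> (* (i) *)
       forall (U : 'M[R[i]]_m) (V : 'M[R[i]]_n),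
         U \is unitarymx -> V \is unitarymx ->
         \det (1%:M + U *m A *m V *m B) != 0;
       (* (ii) *)
       exists gamma xi : R, (xi = -1 \/ xi = 1) /\
         let P : 'M[R[i]]_(n + m) :=
           block_mx (- xi * gamma ^+ 2)%:C%:M 0 0 (xi%:C%:M) in
         [/\ P \is hermsymmx,
             loewner_lt (row_mx 1%:M (- A ^t*) *m P *m col_mx 1%:M (- A)) 0
           & loewner_lt 0 (row_mx (B ^t*) 1%:M *m P *m col_mx B 1%:M)];
       (* (iii) *)
       singular_value A 1 * singular_value B 1 < 1 \/
       1 < singular_value A n * singular_value B m].
Proof.
split=> [detN0|].
  have [g [xi [xi1 HA HB]]] := multiplier_of_singular_values m_gt0 n_gt0
    (singular_values_of_det_neq0 m_gt0 n_gt0 detN0).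
  exists g, xi; split=> //=; rewrite form_left form_right.
  by split; [exact: hermsym_multiplier|exact/loewner_lt0_affine|exact/loewner_gt0_affine].
split=> [[g [xi [xi1 /= [_]]]]|sAB U V Uu Vu].
  rewrite form_left form_right => /loewner_lt0_affine HA /loewner_gt0_affine HB.
  exact: singular_values_of_multiplier HA HB.
exact: det_neq0_of_singular_values.
Qed.
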